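(* Let $n\ge3$, let $(\Sigma,g)$ be a smooth closed $(n-1)$-dimensional Riemannian manifold, let $H$ be a constant, and let $\phi$ be a smooth function on $\Sigma$, satisfying $H>(n-1)\phi>0$ on $\Sigma$ and $$\min_\Sigma(R_g)>\frac{n-2}{n-1}\left((n-1)\max_\Sigma(\phi)+H\right)^2,$$ where $R_g$ is the scalar curvature of $g$. Then there exist a Riemannian metric $\gamma$ and a divergence-free vector field $E$ on $M=\Sigma\times[0,1]$ satisfying $R_\gamma\ge (n-1)(n-2)|E|_\gamma^2$, such that one boundary component is a minimal surface, and on the other the induced metric is $g$, the outward-pointing mean curvature is $H$, and the outward normal component of $E$ is $\phi$.
   Context: $R_\gamma$ denotes the scalar curvature of $\gamma$, and divergence is taken with respect to $\gamma$. Mean curvature is the trace of the second fundamental form, with the convention that the boundary of the unit ball in $\mathbb{R}^n$ has outward-pointing mean curvature $n-1$. A minimal surface is a hypersurface with zero mean curvature. The outward normal component of $E$ on a boundary component is $\gamma(E,\nu)$ with $\nu$ the outward unit normal. (A tuple $(\Sigma,g,H,\phi)$ as in the claim is called charged Bartnik data.) *)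

(* Defs.v *)
(* Differential geometry in local coordinates: a manifold
   is a space with an atlas, a tensor field is the family of its components in
   the charts of the atlas together with the transformation rule on overlaps.
   Coordinates, tangent vectors and components are row vectors 'rV[R]_n. *)
From mathcomp Require Import all_boot all_order all_algebra.
From mathcomp Require Import all_classical all_reals all_analysis.
Import Order.TTheory GRing.Theory Num.Theory.
Import numFieldNormedType.Exports.

Set Implicit Arguments.
Unset Strict Implicit.
Unset Printing Implicit Defensive.

Local Open Scope classical_set_scope.
Local Open Scope ring_scope.

Section LocalCoordinates.
Context {R : realType} {n : nat}.

Definition pd (a : 'I_n) (f : 'rV[R]_n -> R) (x : 'rV[R]_n) : R :=
  'D_(delta_mx 0 a) f x.

Fixpoint Ck (k : nat) (U : set 'rV[R]_n) (f : 'rV[R]_n -> R) : Prop :=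
  (forall x, U x -> {for x, continuous f}) /\
  match k with
  | 0%N => True
  | k'.+1 => forall a : 'I_n,
      (forall x, U x -> derivable f x (delta_mx 0 a)) /\ Ck k' U (pd a f)
  end.

(* For a set A that is not open (a chart image touching the boundary),
   smoothness on A means smoothness on an open neighbourhood of A.  When A lies
   in the closure of its interior, the partial derivatives of f at points of A
   depend only on the values of f on A. *)
Definition smooth_on (A : set 'rV[R]_n) (f : 'rV[R]_n -> R) : Prop :=
  exists U : set 'rV[R]_n, [/\ open U, A `<=` U & forall k, Ck k U f].

Implicit Types (G : 'rV[R]_n -> 'M[R]_n) (X : 'rV[R]_n -> 'rV[R]_n).

Definition metric_dot (S : 'M[R]_n) (v w : 'rV[R]_n) : R := (v *m S *m w^T) 0 0.

(* christoffel G x c a b = Gamma^c_{ab} *)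
Definition christoffel G (x : 'rV[R]_n) (c a b : 'I_n) : R :=
  2^-1 * \sum_(l < n) invmx (G x) c l *
    (pd a (fun y => G y b l) x + pd b (fun y => G y a l) x
     - pd l (fun y => G y a b) x).

(* riemann G x l k i j = dx^l (Rm(e_i, e_j) e_k) *)
Definition riemann G (x : 'rV[R]_n) (l k i j : 'I_n) : R :=
  pd i (fun y => christoffel G y l j k) x
  - pd j (fun y => christoffel G y l i k) x
  + \sum_(m < n) (christoffel G x l i m * christoffel G x m j k
                  - christoffel G x l j m * christoffel G x m i k).

Definition ricci G (x : 'rV[R]_n) (k j : 'I_n) : R :=
  \sum_(i < n) riemann G x i k i j.

Definition scalar_curvature G (x : 'rV[R]_n) : R :=
  \sum_(k < n) \sum_(j < n) invmx (G x) k j * ricci G x k j.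

(* covariant G X x a c is the c-th component of nabla_{e_a} X *)
Definition covariant G X (x : 'rV[R]_n) (a c : 'I_n) : R :=
  pd a (fun y => X y 0 c) x + \sum_(e < n) christoffel G x c a e * X x 0 e.

Definition divergence G X (x : 'rV[R]_n) : R := \sum_(a < n) covariant G X x a a.

(* Row-vector convention: a tangent vector v is pushed forward to v *m Jac f x. *)
Definition Jac (f : 'rV[R]_n -> 'rV[R]_n) (x : 'rV[R]_n) : 'M[R]_n :=
  \matrix_(a, b) pd a (fun y => f y 0 b) x.

End LocalCoordinates.

(* Only the values of chart i on cdom i, and of cinv i on the chart image,
   matter. *)
Record atlas (R : realType) (n : nat) (T : Type) := Atlas {
  chart_index : Type;
  cdom : chart_index -> set T;
  chart : chart_index -> T -> 'rV[R]_n;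
  cinv : chart_index -> 'rV[R]_n -> T
}.

Section Manifolds.
Context {R : realType} {n : nat}.

Definition cimage {T : Type} (A : atlas R n T) (i : chart_index A) : set 'rV[R]_n :=
  chart i @` cdom i.

Definition transition {T : Type} (A : atlas R n T) (i j : chart_index A)
    (x : 'rV[R]_n) : 'rV[R]_n := chart j (cinv i x).

(* A smooth compact manifold without boundary, not necessarily connected; second
   countability follows from compactness and the existence of charts. *)
Record closed_manifold (T : topologicalType) (A : atlas R n T) : Prop := {
  cm_compact : compact [set: T];
  cm_hausdorff : hausdorff_space T;
  cm_cover : forall p : T, exists i : chart_index A, cdom i p;
  cm_open_dom : forall i : chart_index A, open (cdom i);
  cm_open_image : forall i : chart_index A, open (cimage i);
  cm_cancel : forall (i : chart_index A) (p : T), cdom i p -> cinv i (chart i p) = p;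
  cm_chart_cont : forall (i : chart_index A) (p : T), cdom i p ->
    {for p, continuous (chart i)};
  cm_cinv_cont : forall (i : chart_index A) (x : 'rV[R]_n), cimage i x ->
    {for x, continuous (cinv i)};
  cm_transition : forall (i j : chart_index A) (a : 'I_n),
    smooth_on (chart i @` (cdom i `&` cdom j)) (fun x => transition i j x 0 a)
}.

Definition smooth_function {T : Type} (A : atlas R n T) (f : T -> R) : Prop :=
  forall i : chart_index A, smooth_on (cimage i) (fun x => f (cinv i x)).

Record riemannian_metric {T : Type} (A : atlas R n T)
    (g : chart_index A -> 'rV[R]_n -> 'M[R]_n) : Prop := {
  rm_smooth : forall (i : chart_index A) (a b : 'I_n),
    smooth_on (cimage i) (fun x => g i x a b);
  rm_sym : forall (i : chart_index A) (x : 'rV[R]_n), cimage i x -> (g i x)^T = g i x;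
  rm_pos : forall (i : chart_index A) (x : 'rV[R]_n), cimage i x ->
    forall v : 'rV[R]_n, v != 0 -> 0 < metric_dot (g i x) v v;
  rm_transform : forall (i j : chart_index A) (p : T), cdom i p -> cdom j p ->
    let J := Jac (transition i j) (chart i p) in
    g i (chart i p) = J *m g j (chart j p) *m J^T
}.

Record vector_field {T : Type} (A : atlas R n T)
    (X : chart_index A -> 'rV[R]_n -> 'rV[R]_n) : Prop := {
  vf_smooth : forall (i : chart_index A) (a : 'I_n),
    smooth_on (cimage i) (fun x => X i x 0 a);
  vf_transform : forall (i j : chart_index A) (p : T), cdom i p -> cdom j p ->
    X j (chart j p) = X i (chart i p) *m Jac (transition i j) (chart i p)
}.

(* The set of values of the scalar curvature on the manifold. *)
Definition scalar_curvature_values {T : Type} (A : atlas R n T)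
    (g : chart_index A -> 'rV[R]_n -> 'M[R]_n) : set R :=
  [set r | exists (i : chart_index A) (x : 'rV[R]_n),
     cimage i x /\ r = scalar_curvature (g i) x].

End Manifolds.

Arguments cimage {R n T} A i _.
Arguments transition {R n T} A i j x.
Arguments closed_manifold {R n T} A.
Arguments smooth_function {R n T} A f.
Arguments riemannian_metric {R n T} A g.
Arguments vector_field {R n T} A X.
Arguments scalar_curvature_values {R n T} A g _.

Definition is_min {R : realType} (S : set R) (m : R) : Prop := S m /\ lbound S m.
Definition is_max {R : realType} (S : set R) (m : R) : Prop := S m /\ ubound S m.

Section Cylinder.
Context {R : realType} {d : nat}.

Definition cyl_coord (t : R) (x : 'rV[R]_d) : 'rV[R]_(1 + d) :=
  row_mx (const_mx t : 'rV_1) x.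

(* The manifold with boundary Sigma x [0,1], as a subset of T * R, with the
   product charts (p, t) |-> (t, chart i p), whose images are V x [0,1]. *)
Definition cyl_atlas {T : Type} (A : atlas R d T) : atlas R (1 + d) (T * R) :=
  @Atlas R (1 + d) (T * R) (chart_index A)
    (fun i => [set p | cdom i p.1 /\ 0 <= p.2 <= 1])
    (fun i p => cyl_coord p.2 (chart i p.1))
    (fun i y => (cinv i (rsubmx y), lsubmx y 0 0)).

(* The boundary component Sigma x {1} is encoded by true, Sigma x {0} by
   false. *)
Definition face (b : bool) (x : 'rV[R]_d) : 'rV[R]_(1 + d) := cyl_coord b%:R x.

Implicit Types (G : 'rV[R]_(1 + d) -> 'M[R]_(1 + d)).

(* The field +/- grad t / |grad t|; its restriction to the face b is the
   outward unit normal there. *)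
Definition outward_normal G (b : bool) (y : 'rV[R]_(1 + d)) : 'rV[R]_(1 + d) :=
  let K := invmx (G y) in
  ((if b then 1 else -1) / Num.sqrt (K (lshift d ord0) (lshift d ord0)))
    *: row (lshift d ord0) K.

(* Pullback of the metric by x |-> face b x, whose differential maps a tangent
   vector v to row_mx 0 v. *)
Definition induced_metric G (b : bool) (x : 'rV[R]_d) : 'M[R]_d :=
  drsubmx (G (face b x)).

(* II(e_a, e_c) = <nabla_{e_a} nu, e_c> for the tangent directions e_a, e_c and
   the outward unit normal nu: the unit sphere has II equal to its metric. *)
Definition second_form G (b : bool) (x : 'rV[R]_d) : 'M[R]_d :=
  \matrix_(a, c) \sum_(e < 1 + d)
    covariant G (outward_normal G b) (face b x) (rshift 1 a) e
    * G (face b x) e (rshift 1 c).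

Definition mean_curvature G (b : bool) (x : 'rV[R]_d) : R :=
  \tr (invmx (induced_metric G b x) *m second_form G b x).

End Cylinder.

(* Main.v *)
Require Import Defs.
From mathcomp Require Import all_boot all_order all_algebra.
From mathcomp Require Import all_classical all_reals all_analysis.
From mathcomp Require Import ring lra.
Import Order.TTheory GRing.Theory Num.Theory.
Import numFieldNormedType.Exports.

Set Implicit Arguments.
Unset Strict Implicit.
Unset Printing Implicit Defensive.

Local Open Scope classical_set_scope.
Local Open Scope ring_scope.

(* The metric is the charged (Reissner-Nordstroem) black hole collar
   gamma = ds^2 + u(s)^2 g with E = phi u^(1-n) d/ds, which is divergence free
   whatever the warping function u is.  With
   (u')^2 = K - 2 mu u^(2-n) + q^2 u^(4-2n), q = max phi, the scalar curvature is
   (R_g - (n-1)(n-2) K) / u^2 + (n-1)(n-2) q^2 u^(2-2n), so the curvature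
   condition holds as soon as (n-1)(n-2) K <= min R_g.  The right-hand side must
   equal (H/(n-1))^2 at u = 1 and have a simple zero, the horizon, below u = 1;
   in terms of z = u^(n-2) it is K (z - z0)(z - z1) / z^2, and such a K with
   roots 0 < z1 < z0 < 1 exists because
   min R_g > (n-1)(n-2) (q + H/(n-1))^2.  Replacing s by the parameter t with
   z = z0 + (1 - z0) t^2 makes the coefficients of gamma and E explicit smooth
   functions of t on the whole line, the horizon t = 0 included. *)

(** * Smooth functions of several variables *)

(** Both difference quotients are the same function of [h], so the derivatives agree even at points
    where [f] has none. Christoffel symbols and chart transitions can thus be differentiated on the
    cylinder with no regularity argument. *)
Lemma derive_comp_affine {R : numFieldType} {V W Z : normedModType R} (L : V -> W)
    (f : W -> Z) (v w : V) :
  (forall h : R, L (h *: v + w) = h *: L v + L w) ->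
  'D_v (f \o L) w = 'D_(L v) f (L w).
Proof.
move=> L1; rewrite /derive; set F := fun h => h^-1 *: _; set G := fun h => h^-1 *: _.
by suff -> : F = G by []; apply: funext => h; rewrite /F /G /= L1.
Qed.

Lemma derivable_comp_affine {R : numFieldType} {V W Z : normedModType R} (L : V -> W)
    (f : W -> Z) (v w : V) :
  (forall h : R, L (h *: v + w) = h *: L v + L w) ->
  derivable f (L w) (L v) -> derivable (f \o L) w v.
Proof.
move=> L1; rewrite /derivable; set F := fun h => h^-1 *: _; set G := fun h => h^-1 *: _.
by suff -> : F = G by []; apply: funext => h; rewrite /F /G /= L1.
Qed.

Section Smoothness.
Context {R : realType} {n : nat}.
Implicit Types (U : set 'rV[R]_n) (f h : 'rV[R]_n -> R).

Lemma pd_eq_on U f h (a : 'I_n) x : open U -> U x ->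
  (forall y, U y -> f y = h y) -> pd a f x = pd a h x.
Proof.
move=> oU Ux fh; apply: near_eq_derive.
by near=> y; apply: fh; near: y; exact: open_nbhs_nbhs.
Unshelve. all: by end_near. Qed.

Lemma derivable_eq_on U f h (v : 'rV[R]_n) x : open U -> U x ->
  (forall y, U y -> f y = h y) -> derivable f x v -> derivable h x v.
Proof.
move=> oU Ux fh; apply: near_eq_derivable.
by near=> y; apply: fh; near: y; exact: open_nbhs_nbhs.
Unshelve. all: by end_near. Qed.

Lemma continuous_eq_on U f h x : open U -> U x ->
  (forall y, U y -> f y = h y) -> {for x, continuous f} -> {for x, continuous h}.
Proof.
move=> oU Ux fh fc.
have hf : h y @[y --> x] --> h x.
  rewrite -(fh x Ux); apply: cvg_trans fc; apply: (@near_eq_cvg _ _ (nbhs x)).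
  by near=> y; apply: fh; near: y; exact: open_nbhs_nbhs.
exact: hf.
Unshelve. all: by end_near. Qed.

(** Openness of [U] lets a partial derivative be replaced by a formula valid only on [U], which is
    how the product and power rules enter the inductions below. *)
Lemma Ck_eq_on U k f h : open U ->
  (forall y, U y -> f y = h y) -> Ck k U f -> Ck k U h.
Proof.
move=> oU; elim: k f h => [|k IH] f h fh /= [fc fd]; split => //.
- by move=> x Ux; exact: continuous_eq_on oU Ux fh (fc x Ux).
- by move=> x Ux; exact: continuous_eq_on oU Ux fh (fc x Ux).
move=> a; have [da ka] := fd a; split.
  by move=> x Ux; apply: derivable_eq_on oU Ux fh (da x Ux).
by apply: IH ka => y Uy; exact: pd_eq_on oU Uy fh.
Qed.

Lemma Ck_subset k (U U' : set 'rV[R]_n) f : U `<=` U' -> Ck k U' f -> Ck k U f.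
Proof.
move=> sUU; elim: k f => [|k IH] f /= [fc fd]; split => //; first by move=> x /sUU /fc.
  by move=> x /sUU /fc.
by move=> a; have [da ka] := fd a; split; [move=> x /sUU /da | exact: IH].
Qed.

Lemma CkW k U f : Ck k.+1 U f -> Ck k U f.
Proof.
elim: k f => [|k IH] f; first by case.
by move=> [fc fd]; split => // a; have [da ka] := fd a; split => //; exact: IH.
Qed.

Lemma Ck_continuous k U f : Ck k U f -> forall x, U x -> {for x, continuous f}.
Proof. by case: k => [|k] []. Qed.

Lemma Ck_cst k U (r : R) : Ck k U (fun=> r).
Proof.
elim: k r => [|k IH] r /=; split => //; try by move=> x _; exact: cst_continuous.
move=> a; split; first by move=> x _; exact: derivable_cst.
have -> : pd a (fun=> r) = (fun=> 0) :> ('rV[R]_n -> R); last exact: IH.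
by apply: funext => x; exact: derive_cst.
Qed.

Lemma Ck_add U k f h : open U -> Ck k U f -> Ck k U h ->
  Ck k U (fun x => f x + h x).
Proof.
move=> oU; elim: k f h => [|k IH] f h [fc fd] [hc hd]; split => //.
- by move=> x Ux; apply: continuousD; [exact: fc | exact: hc].
- by move=> x Ux; apply: continuousD; [exact: fc | exact: hc].
move=> a; have [fa fk] := fd a; have [ha hk] := hd a; split.
  by move=> x Ux; apply: derivableD; [exact: fa | exact: ha].
apply: Ck_eq_on (IH _ _ fk hk) => // y Uy.
by rewrite /pd deriveD //; [exact: fa | exact: ha].
Qed.

Lemma Ck_mul U k f h : open U -> Ck k U f -> Ck k U h ->
  Ck k U (fun x => f x * h x).
Proof.
move=> oU; elim: k f h => [|k IH] f h Cf Ch; split => //.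
- by move=> x Ux; apply: continuousM; [exact: Cf.1 | exact: Ch.1].
- by move=> x Ux; apply: continuousM; [exact: Cf.1 | exact: Ch.1].
move=> a; have [fa fk] := Cf.2 a; have [ha hk] := Ch.2 a; split.
  by move=> x Ux; apply: derivableM; [exact: fa | exact: ha].
have := Ck_add oU (IH _ _ (CkW Cf) hk) (IH _ _ (CkW Ch) fk).
apply: Ck_eq_on => // y Uy; rewrite /pd [RHS]deriveM //; [exact: fa | exact: ha].
Qed.

(** Restricting to the line through [x] in direction [v] reduces this to the one-variable chain
    rule. *)
Lemma is_derive_comp1 (F : R -> R) (dF : R) f (x v : 'rV[R]_n) :
  is_derive (f x) 1 F dF -> derivable f x v ->
  is_derive x v (F \o f) (dF * 'D_v f x).
Proof.
move=> dFx dfx.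
have line (k : 'rV[R]_n -> R) : 'D_v k x = 'D_1 (fun h : R => k (h *: v + x)) 0.
  rewrite /derive; set A := fun r => r^-1 *: _; set B := fun r => r^-1 *: _.
  suff -> : A = B by [].
  by apply: funext => h; rewrite /A /B /= scale0r add0r addr0 [_%:A]mulr1.
have dl := derivableP ((derivable1P _ _ _).1 dfx).
have dFl : is_derive (f (0 *: v + x)) 1 F dF by rewrite scale0r add0r.
have [d1 d2] := is_derive1_comp dFl dl.
by split; [exact/derivable1P | rewrite !line].
Qed.

Lemma is_derive_comp_powR f (p : R) (x v : 'rV[R]_n) : 0 < f x -> derivable f x v ->
  is_derive x v (fun y => f y `^ p) (p * f x `^ (p - 1) * 'D_v f x).
Proof. by move=> f0 df; exact: (is_derive_comp1 (is_derive1_powR p f0) df). Qed.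

Lemma Ck_powR U k f (p : R) : open U -> (forall x, U x -> 0 < f x) ->
  Ck k U f -> Ck k U (fun x => f x `^ p).
Proof.
(* The exponent is generalised because differentiating lowers it to [p - 1]. *)
move=> oU f0; elim: k f p f0 => [|k IH] f p f0 Cf.
  split => // x Ux; apply: (@continuous_comp _ _ _ f (@powR R ^~ p)).
    exact: Cf.1.
  apply/differentiable_continuous/derivable1_diffP.
  by have [] := is_derive1_powR p (f0 x Ux).
split.
  exact: Ck_continuous (IH f p f0 (CkW Cf)).
move=> a; have [fa fk] := Cf.2 a.
have dp x : U x -> is_derive x (delta_mx 0 a) (fun y => f y `^ p)
    (p * f x `^ (p - 1) * pd a f x).
  by move=> Ux; apply: is_derive_comp_powR; [exact: f0 | exact: fa].
split; first by move=> x Ux; have [] := dp x Ux.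
have := Ck_mul oU (Ck_mul oU (Ck_cst k U p) (IH f (p - 1) f0 (CkW Cf))) fk.
by apply: Ck_eq_on => // y Uy; have [_ <-] := dp y Uy.
Qed.

End Smoothness.

(** Since [L] sends each basis vector to zero or to a basis vector, a partial derivative of [f \o L]
    is zero or again of the form [pd b f \o L], and the induction closes. *)
Lemma Ck_comp_linear {R : realType} {m n : nat} (L : 'rV[R]_m -> 'rV[R]_n) k
    (U : set 'rV[R]_n) (f : 'rV[R]_n -> R) : continuous L -> linear L ->
    (forall a, L (delta_mx 0 a) = 0 \/ exists b, L (delta_mx 0 a) = delta_mx 0 b) ->
  Ck k U f -> Ck k (L @^-1` U) (f \o L).
Proof.
move=> Lc Ll Ld; elim: k f => [|k IH] f Cf; split => //.
- by move=> x Ux; apply: continuous_comp; [exact: Lc | exact: Cf.1].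
- by move=> x Ux; apply: continuous_comp; [exact: Lc | exact: Cf.1].
move=> a; have L1 x (h : R) : L (h *: delta_mx 0 a + x) = h *: L (delta_mx 0 a) + L x.
  exact: Ll.
have -> : pd a (f \o L) = fun x => 'D_(L (delta_mx 0 a)) f (L x).
  by apply: funext => x; rewrite /pd derive_comp_affine.
have [La|[b La]] := Ld a; split.
- by move=> x Ux; apply: derivable_comp_affine => //; rewrite La; exact: derivable0.
- have -> : (fun x => 'D_(L (delta_mx 0 a)) f (L x)) = fun=> 0.
    by apply: funext => x; rewrite La derive0.
  exact: Ck_cst.
- move=> x Ux; apply: derivable_comp_affine => //; rewrite La.
  exact: (Cf.2 b).1.
- have := IH _ (Cf.2 b).2; suff -> : (fun x => 'D_(L (delta_mx 0 a)) f (L x)) = pd b f \o L by [].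
  by apply: funext => x; rewrite La.
Qed.

(** * Warped products over an interval *)

Section ProductCoordinates.
Context {R : realType} {d : nat}.

(** [o] is the index of the interval direction, [r a] that of the [a]-th direction along the
    slice. *)
Notation o := (lshift d (@ord0 0)).
Notation r := (rshift 1).

Definition tcoord (y : 'rV[R]_(1 + d)) : R := lsubmx y 0 0.

Lemma tcoord_linear (h : R) (v w : 'rV[R]_(1 + d)) :
  tcoord (h *: v + w) = h *: tcoord v + tcoord w.
Proof. by rewrite /tcoord !mxE. Qed.

Lemma rsubmx_linear (h : R) (v w : 'rV[R]_(1 + d)) :
  rsubmx (h *: v + w) = h *: rsubmx v + rsubmx w.
Proof. by rewrite linearP. Qed.

Lemma tcoord_cyl_coord (t : R) (x : 'rV[R]_d) : tcoord (cyl_coord t x) = t.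
Proof. by rewrite /tcoord /cyl_coord row_mxKl mxE. Qed.

Lemma rsubmx_cyl_coord (t : R) (x : 'rV[R]_d) : rsubmx (cyl_coord t x) = x.
Proof. exact: row_mxKr. Qed.

Lemma tcoord_delta_l : tcoord (delta_mx 0 o) = 1.
Proof. by rewrite /tcoord !mxE !eqxx. Qed.

Lemma tcoord_delta_r a : tcoord (delta_mx 0 (r a)) = 0.
Proof. by rewrite /tcoord !mxE eq_lrshift andbF. Qed.

Lemma rsubmx_delta_l : rsubmx (delta_mx 0 o) = 0 :> 'rV[R]_d.
Proof. by apply/rowP => a; rewrite !mxE eq_rlshift andbF. Qed.

Lemma rsubmx_delta_r a : rsubmx (delta_mx 0 (r a)) = delta_mx 0 a :> 'rV[R]_d.
Proof. by apply/rowP => b; rewrite !mxE eq_rshift. Qed.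

Implicit Types (F : R -> R) (f : 'rV[R]_d -> R).

(** The factor [f (rsubmx y)] is constant in the interval direction, so only [F] has to be
    derivable; [pd_mul_r] is the mirror case. *)
Lemma pd_mul_l F f y : derivable F (tcoord y) 1 ->
  pd o (fun y => F (tcoord y) * f (rsubmx y)) y
  = 'D_1 F (tcoord y) * f (rsubmx y).
Proof.
move=> dF; rewrite /pd.
have tl h := @tcoord_linear h (delta_mx 0 o) y.
have rl h := @rsubmx_linear h (delta_mx 0 o) y.
rewrite (@deriveM _ _ (F \o tcoord) (f \o rsubmx)).
- rewrite (derive_comp_affine F tl) (derive_comp_affine f rl) tcoord_delta_l rsubmx_delta_l derive0.
  by rewrite scaler0 add0r mulrC.
- by apply: (derivable_comp_affine tl); rewrite tcoord_delta_l.
- by apply: (derivable_comp_affine rl); rewrite rsubmx_delta_l; exact: derivable0.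
Qed.

Lemma pd_mul_r F f (a : 'I_d) y : derivable f (rsubmx y) (delta_mx 0 a) ->
  pd (r a) (fun y => F (tcoord y) * f (rsubmx y)) y
  = F (tcoord y) * pd a f (rsubmx y).
Proof.
move=> df; rewrite /pd.
have tl h := @tcoord_linear h (delta_mx 0 (r a)) y.
have rl h := @rsubmx_linear h (delta_mx 0 (r a)) y.
rewrite (@deriveM _ _ (F \o tcoord) (f \o rsubmx)).
- rewrite (derive_comp_affine F tl) (derive_comp_affine f rl) tcoord_delta_r rsubmx_delta_r derive0.
  by rewrite scaler0 addr0.
- by apply: (derivable_comp_affine tl); rewrite tcoord_delta_r; exact: derivable0.
- by apply: (derivable_comp_affine rl); rewrite rsubmx_delta_r.
Qed.

Lemma pd_tcoord_l F y : pd o (fun y => F (tcoord y)) y = 'D_1 F (tcoord y).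
Proof.
rewrite -tcoord_delta_l.
exact: (derive_comp_affine F (fun h => tcoord_linear h (delta_mx 0 o) y)).
Qed.

Lemma pd_tcoord_r F a y : pd (r a) (fun y => F (tcoord y)) y = 0.
Proof.
rewrite /pd (derive_comp_affine F (fun h => tcoord_linear h (delta_mx 0 (r a)) y)).
by rewrite tcoord_delta_r derive0.
Qed.

Lemma pd_rsubmx_l f y : pd o (fun y => f (rsubmx y)) y = 0.
Proof.
rewrite /pd (derive_comp_affine f (fun h => rsubmx_linear h (delta_mx 0 o) y)).
by rewrite rsubmx_delta_l derive0.
Qed.

Lemma pd_rsubmx_r f a y : pd (r a) (fun y => f (rsubmx y)) y = pd a f (rsubmx y).
Proof.
rewrite /pd (derive_comp_affine f (fun h => rsubmx_linear h (delta_mx 0 (r a)) y)).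
by rewrite rsubmx_delta_r.
Qed.

Lemma sum_cyl (F : 'I_(1 + d) -> R) :
  \sum_i F i = F o + \sum_(i < d) F (r i).
Proof. by rewrite big_split_ord big_ord1. Qed.

End ProductCoordinates.

Section WarpedProduct.
Context {R : realType} {d : nat}.

(** The coefficient [P] is kept general because the parameter of the collar is not arc length. In
    the comparisons below, arc length means [P = 1], [al = 0], and [Q = u^2], [be = u'/u]. *)
Definition warped (P Q : R -> R) (g : 'rV[R]_d -> 'M[R]_d) (y : 'rV[R]_(1 + d)) :
    'M[R]_(1 + d) :=
  block_mx (P (tcoord y))%:M 0 0 (Q (tcoord y) *: g (rsubmx y)).

(* [al] and [be] are half the logarithmic derivatives of [P] and [Q]: the
   Christoffel symbols and the curvature only involve these. *)
Context (P Q al be dbe : R -> R) (g : 'rV[R]_d -> 'M[R]_d) (V : set 'rV[R]_d).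
Context (P0 : forall t, 0 < P t) (Q0 : forall t, 0 < Q t).
Context (dP : forall t : R, is_derive t 1 P (2 * al t * P t)).
Context (dQ : forall t : R, is_derive t 1 Q (2 * be t * Q t)).
Context (dB : forall t : R, is_derive t 1 be (dbe t)).
Context (oV : open V) (gsym : forall x, V x -> (g x)^T = g x).
Context (gunit : forall x, V x -> g x \in unitmx).
Context (gder : forall x, V x -> forall a b c : 'I_d,
  derivable (fun y => g y b c) x (delta_mx 0 a)).

Notation W := (warped P Q g).
Notation o := (lshift d (@ord0 0)).
Notation r := (rshift 1).

(** * Inverse metric and Christoffel symbols of a warped product *)

Lemma open_cylinder : open ((@rsubmx R 1 1 d) @^-1` V).
Proof. by apply: open_comp => // y _; exact: continuous_rsubmx. Qed.

Lemma warped_oo y : W y o o = P (tcoord y).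
Proof. by rewrite /warped block_mxEul mxE. Qed.
Lemma warped_or y a : W y o (r a) = 0.
Proof. by rewrite /warped block_mxEur mxE. Qed.
Lemma warped_ro y a : W y (r a) o = 0.
Proof. by rewrite /warped block_mxEdl mxE. Qed.
Lemma warped_rr y a b : W y (r a) (r b) = Q (tcoord y) * g (rsubmx y) a b.
Proof. by rewrite /warped block_mxEdr mxE. Qed.

Lemma invmx_warped y : V (rsubmx y) -> invmx (W y) =
  block_mx (P (tcoord y))^-1%:M 0 0 ((Q (tcoord y))^-1 *: invmx (g (rsubmx y))).
Proof.
move=> Vy; set B := RHS.
have WB : W y *m B = 1%:M.
  rewrite /B /warped mulmx_block !mul0mx !mulmx0 !addr0 !add0r.
  rewrite -scalemxAl -scalemxAr scalerA mulmxV ?gunit // mulfV ?gt_eqF // scale1r.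
  by rewrite -scalar_mxM mulfV ?gt_eqF // -scalar_mx_block.
have [Wu _] := mulmx1_unit WB.
by rewrite -[LHS]mulmx1 -WB mulmxA mulVmx // mul1mx.
Qed.

(** Bundling the four blocks into one tuple lets a single [rewrite] select the applicable equation;
    the next lemmas follow the same pattern. *)
Lemma invmx_warpedE y : V (rsubmx y) ->
  (invmx (W y) o o = (P (tcoord y))^-1) *
  (forall a, invmx (W y) o (r a) = 0) *
  (forall a, invmx (W y) (r a) o = 0) *
  (forall a b, invmx (W y) (r a) (r b) = (Q (tcoord y))^-1 * invmx (g (rsubmx y)) a b).
Proof.
move=> Vy; rewrite invmx_warped //; do ! split => *;
  by rewrite ?(block_mxEul, block_mxEur, block_mxEdl, block_mxEdr) !mxE.
Qed.

Lemma pd_warped y : V (rsubmx y) ->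
  ((pd o (fun y => W y o o) y = 2 * al (tcoord y) * P (tcoord y)) *
  (forall b, pd o (fun y => W y o (r b)) y = 0) *
  (forall b, pd o (fun y => W y (r b) o) y = 0) *
  (forall b c, pd o (fun y => W y (r b) (r c)) y
     = 2 * be (tcoord y) * Q (tcoord y) * g (rsubmx y) b c)) *
  ((forall a, pd (r a) (fun y => W y o o) y = 0) *
  (forall a b, pd (r a) (fun y => W y o (r b)) y = 0) *
  (forall a b, pd (r a) (fun y => W y (r b) o) y = 0) *
  (forall a b c, pd (r a) (fun y => W y (r b) (r c)) y
     = Q (tcoord y) * pd a (fun x => g x b c) (rsubmx y))).
Proof.
move=> Vy.
have Eoo : (fun y => W y o o) = (fun y => P (tcoord y)).
  by apply: funext => z; exact: warped_oo.
have Eor b : (fun y => W y o (r b)) = (fun=> 0).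
  by apply: funext => z; exact: warped_or.
have Ero b : (fun y => W y (r b) o) = (fun=> 0).
  by apply: funext => z; exact: warped_ro.
have Err b c : (fun y => W y (r b) (r c)) = (fun y => Q (tcoord y) * g (rsubmx y) b c).
  by apply: funext => z; exact: warped_rr.
have z a' : pd a' (fun=> 0) y = 0 :> R by exact: derive_cst.
do ! split => *; rewrite ?(Eoo, Eor, Ero, Err, z) //.
- by rewrite pd_tcoord_l; have [_ ->] := dP (tcoord y).
- rewrite (@pd_mul_l _ _ _ (fun x => g x _ _)); have [//= _ ->] := dQ (tcoord y).
  by [].
- exact: pd_tcoord_r.
- by rewrite (@pd_mul_r _ _ _ (fun x => g x _ _)) //; exact: gder.
Qed.

(** The inverse metric is block diagonal, so the sum over [l] keeps either its [o] term or its slice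
    terms. In the pure slice components [Q] cancels, as Christoffel symbols are unchanged by
    constant scaling. *)
Lemma christoffel_warped y : V (rsubmx y) ->
  ((christoffel W y o o o = al (tcoord y)) *
  (forall a, christoffel W y o o (r a) = 0) *
  (forall a, christoffel W y o (r a) o = 0) *
  (forall a b, christoffel W y o (r a) (r b) =
     - (be (tcoord y) * Q (tcoord y) / P (tcoord y)) * g (rsubmx y) a b)) *
  ((forall a, christoffel W y (r a) o o = 0) *
  (forall a b, christoffel W y (r a) o (r b) = be (tcoord y) * (a == b)%:R) *
  (forall a b, christoffel W y (r a) (r b) o = be (tcoord y) * (a == b)%:R) *
  (forall c a b, christoffel W y (r c) (r a) (r b) = christoffel g (rsubmx y) c a b)).
Proof.
move=> Vy; have Pn0 : P (tcoord y) != 0 by rewrite gt_eqF.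
have Qn0 : Q (tcoord y) != 0 by rewrite gt_eqF.
have delta a b : \sum_l invmx (g (rsubmx y)) a l * g (rsubmx y) b l = (a == b)%:R.
  have := mulVmx (gunit Vy) => /matrixP/(_ a b); rewrite !mxE => <-.
  by apply: eq_bigr => l _; congr (_ * _); rewrite -[in LHS](gsym Vy) mxE.
have be_delta a b : 2^-1 * \sum_(l < d) (Q (tcoord y))^-1 * invmx (g (rsubmx y)) a l *
     (2 * be (tcoord y) * Q (tcoord y) * g (rsubmx y) b l) = be (tcoord y) * (a == b)%:R.
  rewrite -delta !mulr_sumr; apply: eq_bigr => l _; field; exact: Qn0.
do ! split => *; rewrite /christoffel sum_cyl !(invmx_warpedE Vy, pd_warped Vy) /=.
- rewrite big1 => [|l _]; first by field.
  by rewrite !(invmx_warpedE Vy) mul0r.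
- rewrite big1 => [|l _]; first by ring.
  by rewrite !(invmx_warpedE Vy) mul0r.
- rewrite big1 => [|l _]; first by ring.
  by rewrite !(invmx_warpedE Vy) mul0r.
- rewrite big1 => [|l _]; first by field.
  by rewrite !(invmx_warpedE Vy) mul0r.
- rewrite big1 => [|l _]; first by ring.
  by rewrite !(pd_warped Vy); ring.
- rewrite -be_delta mul0r add0r; congr (_ * _); apply: eq_bigr => l _.
  by rewrite !(invmx_warpedE Vy, pd_warped Vy); ring.
- rewrite -be_delta mul0r add0r; congr (_ * _); apply: eq_bigr => l _.
  by rewrite !(invmx_warpedE Vy, pd_warped Vy); ring.
- rewrite mul0r add0r; congr (_ * _); apply: eq_bigr => l _.
  by rewrite !(invmx_warpedE Vy, pd_warped Vy); field.
Qed.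

(** These are the derivatives that enter the two diagonal blocks of the Ricci tensor. The mixed
    block is never computed, because the inverse metric has no mixed entries to contract it with. *)
Lemma pd_christoffel_warped y : V (rsubmx y) ->
  ((forall a b, pd o (fun y => christoffel W y o (r a) (r b)) y =
     - ((dbe (tcoord y) + 2 * be (tcoord y) ^+ 2 - 2 * al (tcoord y) * be (tcoord y))
        * Q (tcoord y) / P (tcoord y)) * g (rsubmx y) a b) *
  (forall a b, pd o (fun y => christoffel W y (r a) (r b) o) y
     = dbe (tcoord y) * (a == b)%:R)) *
  ((forall a b, pd (r a) (fun y => christoffel W y o o (r b)) y = 0) *
  (forall a b, pd (r a) (fun y => christoffel W y (r b) o o) y = 0) *
  (forall e a b c, pd (r e) (fun y => christoffel W y (r c) (r a) (r b)) y
     = pd e (fun x => christoffel g x c a b) (rsubmx y))).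
Proof.
move=> Vy; have near a' f h := @pd_eq_on _ _ _ f h a' y open_cylinder Vy.
have z a' : pd a' (fun=> 0) y = 0 :> R by exact: derive_cst.
do ! split.
- move=> a b; pose mu t := - (be t * Q t / P t).
  rewrite (near _ _ (fun y => mu (tcoord y) * g (rsubmx y) a b)); last first.
    by move=> x Vx; rewrite !(christoffel_warped Vx).
  have Pn0 : P (tcoord y) != 0 by rewrite gt_eqF.
  have := dP (tcoord y); have := dQ (tcoord y); have := dB (tcoord y) => hB hQ hP.
  have dmu := is_deriveN (is_deriveM (is_deriveM hB hQ) (is_deriveV Pn0 hP)).
  rewrite (@pd_mul_l _ _ mu (fun x => g x a b)); last by have [] := dmu.
  have [_ ->] := dmu; rewrite /GRing.scale /=.
  by change ((be * Q) (tcoord y)) with (be (tcoord y) * Q (tcoord y)); field.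
- move=> a b; rewrite (near _ _ (fun y => be (tcoord y) * (a == b)%:R)); last first.
    by move=> x Vx; rewrite !(christoffel_warped Vx).
  rewrite (@pd_mul_l _ _ be (fun=> (a == b)%:R)).
    by have [_ ->] := dB (tcoord y).
  by have [] := dB (tcoord y).
- by move=> a b; rewrite (near _ _ (fun=> 0)) // => x Vx; rewrite !(christoffel_warped Vx).
- by move=> a b; rewrite (near _ _ (fun=> 0)) // => x Vx; rewrite !(christoffel_warped Vx).
- move=> e a b c; rewrite (near _ _ (fun y => christoffel g (rsubmx y) c a b)); last first.
    by move=> x Vx; rewrite !(christoffel_warped Vx).
  exact: (pd_rsubmx_r (fun x => christoffel g x c a b)).
Qed.

(** * Ricci and scalar curvature of a warped product *)

Lemma ricci_warped_oo y : V (rsubmx y) -> ricci W y o o =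
  d%:R * (al (tcoord y) * be (tcoord y) - dbe (tcoord y) - be (tcoord y) ^+ 2).
Proof.
move=> Vy; rewrite /ricci sum_cyl /riemann !subrr add0r big1 ?add0r => [|m _]; last first.
  exact: subrr.
rewrite (eq_bigr (fun=> al (tcoord y) * be (tcoord y) - dbe (tcoord y)
  - be (tcoord y) ^+ 2)) ?sumr_const ?card_ord -?[LHS]mulr_natl // => a _.
rewrite !(pd_christoffel_warped Vy) eqxx sum_cyl !(christoffel_warped Vy) eqxx.
rewrite (bigD1 a) //= big1 => [|e ea]; rewrite !(christoffel_warped Vy) ?eqxx.
  by rewrite /= !mulr1n; ring.
by rewrite (negbTE ea) mulr0n; ring.
Qed.

(** In arc length the correction to [ricci g] is the classical [- (u u'' + (d - 1) u'^2) g]. *)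
Lemma ricci_warped_rr y b c : V (rsubmx y) -> ricci W y (r b) (r c) =
  ricci g (rsubmx y) b c + (al (tcoord y) * be (tcoord y) - dbe (tcoord y)
    - d%:R * be (tcoord y) ^+ 2) * Q (tcoord y) / P (tcoord y) * g (rsubmx y) b c.
Proof.
move=> Vy; have Pn0 : P (tcoord y) != 0 by rewrite gt_eqF.
have gbc e f : g (rsubmx y) e f = g (rsubmx y) f e by rewrite -[in LHS](gsym Vy) mxE.
pose m := be (tcoord y) ^+ 2 * Q (tcoord y) / P (tcoord y).
rewrite /ricci sum_cyl.
(* The contraction is split: the term with index [o] is the radial part, and the slice terms follow
   the Gauss equation. *)
have -> : riemann W y o (r b) o (r c) = - ((dbe (tcoord y) + be (tcoord y) ^+ 2
    - al (tcoord y) * be (tcoord y)) * Q (tcoord y) / P (tcoord y)) * g (rsubmx y) b c.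
  rewrite /riemann !(pd_christoffel_warped Vy) sum_cyl !(christoffel_warped Vy).
  rewrite (bigD1 b) //= big1 => [|e eb]; rewrite !(christoffel_warped Vy) ?eqxx.
    by rewrite (gbc c b) /= ?mulr1n; field.
  by rewrite (negbTE eb) mulr0n; ring.
(* Each slice term differs from the curvature of [g] by a constant-curvature expression, whose trace
   over [a] is [m * (d - 1) * g b c]. *)
rewrite (eq_bigr (fun a => riemann g (rsubmx y) a b a c
    - (m * g (rsubmx y) b c - m * (a == c)%:R * g (rsubmx y) a b))); last first.
  move=> a _; rewrite /riemann !(pd_christoffel_warped Vy) sum_cyl.
  rewrite !(christoffel_warped Vy) eqxx.
  under eq_bigr do rewrite !(christoffel_warped Vy).
  move: (pd _ _ _) (pd _ _ _) (\sum_(i < d) _) => p1 p2 S.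
  by rewrite (gbc c b) /m /= mulr1n; field.
rewrite sumrB sumrB sumr_const card_ord [X in _ - (_ - X)](bigD1 c) //=.
rewrite [X in _ - (_ - (_ + X))]big1 => [|a ac].
  move: (\sum_(i < d) _) => S.
  by rewrite eqxx (gbc c b) /m -mulr_natl mulr1n; field.
by rewrite (negbTE ac) mulr0n; ring.
Qed.

(** In arc length this reads [R_g / u^2 - 2 d u''/u - d (d - 1) u'^2 / u^2]. *)
Lemma scalar_curvature_warped y : V (rsubmx y) -> scalar_curvature W y =
  scalar_curvature g (rsubmx y) / Q (tcoord y)
  + d%:R / P (tcoord y) * (2 * al (tcoord y) * be (tcoord y) - 2 * dbe (tcoord y)
      - (d%:R + 1) * be (tcoord y) ^+ 2).
Proof.
move=> Vy; have Pn0 : P (tcoord y) != 0 by rewrite gt_eqF.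
have Qn0 : Q (tcoord y) != 0 by rewrite gt_eqF.
have tr : \sum_(b < d) \sum_(c < d) invmx (g (rsubmx y)) b c * g (rsubmx y) b c = d%:R.
  transitivity (\tr (invmx (g (rsubmx y)) *m g (rsubmx y))); last first.
    by rewrite mulVmx ?gunit // mxtrace1.
  apply: eq_bigr => b _; rewrite mxE; apply: eq_bigr => c _; congr (_ * _).
  by rewrite -[in LHS](gsym Vy) mxE.
rewrite /scalar_curvature sum_cyl sum_cyl big1 => [|c _]; last first.
  by rewrite (invmx_warpedE Vy) mul0r.
rewrite (invmx_warpedE Vy) (ricci_warped_oo Vy) addr0.
pose A := (al (tcoord y) * be (tcoord y) - dbe (tcoord y)
    - d%:R * be (tcoord y) ^+ 2) / P (tcoord y).
rewrite (eq_bigr (fun b => (Q (tcoord y))^-1 *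
    (\sum_c invmx (g (rsubmx y)) b c * ricci g (rsubmx y) b c)
    + A * \sum_c invmx (g (rsubmx y)) b c * g (rsubmx y) b c)) => [|b _]; last first.
  rewrite sum_cyl (invmx_warpedE Vy) mul0r add0r !mulr_sumr -big_split /=.
  apply: eq_bigr => c _; rewrite (invmx_warpedE Vy) (ricci_warped_rr _ _ Vy) /A.
  by field; rewrite Pn0 Qn0.
rewrite big_split /= -!mulr_sumr tr /A; field; rewrite Pn0; exact: Qn0.
Qed.

(** The field points along the interval, and [al + d * be] is the logarithmic derivative of the
    volume density [sqrt (P * Q^d)]; no derivative of [f] appears. *)
Lemma divergence_warped (e : R -> R) (f : 'rV[R]_d -> R) y :
  V (rsubmx y) -> derivable e (tcoord y) 1 ->
  divergence W (fun y => cyl_coord (e (tcoord y) * f (rsubmx y)) 0) y =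
  ('D_1 e (tcoord y) + (al (tcoord y) + d%:R * be (tcoord y)) * e (tcoord y)) * f (rsubmx y).
Proof.
move=> Vy de; rewrite /divergence sum_cyl /covariant !sum_cyl.
have Eo : (fun y => cyl_coord (e (tcoord y) * f (rsubmx y)) 0 0 o) =
    (fun y : 'rV[R]_(1 + d) => e (tcoord y) * f (rsubmx y)).
  by apply: funext => z; rewrite /cyl_coord row_mxEl mxE.
have Er a (t : R) : cyl_coord t (0 : 'rV[R]_d) 0 (r a) = 0.
  by rewrite /cyl_coord row_mxEr mxE.
rewrite Eo pd_mul_l // big1 => [|a _]; last by rewrite Er mulr0.
have -> : cyl_coord (e (tcoord y) * f (rsubmx y)) 0 0 o = e (tcoord y) * f (rsubmx y).
  by rewrite /cyl_coord row_mxEl mxE.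
rewrite (eq_bigr (fun=> be (tcoord y) * (e (tcoord y) * f (rsubmx y)))) => [|a _].
  rewrite sumr_const card_ord -mulr_natl (christoffel_warped Vy).1.1.1.1; ring.
rewrite sum_cyl big1 => [|b _]; last by rewrite Er mulr0.
rewrite (christoffel_warped Vy).2.1.2 eqxx mulr1n /cyl_coord row_mxEl mxE.
have -> : (fun y => row_mx (const_mx (e (tcoord y) * f (rsubmx y)) : 'rV_1)
    (0 : 'rV_d) 0 (r a)) = (fun=> 0) by apply: funext => z; rewrite row_mxEr mxE.
by rewrite /pd derive_cst; ring.
Qed.

(** * Normal, second fundamental form and mean curvature of the boundary slices *)

Lemma outward_normal_warped b y : V (rsubmx y) -> outward_normal W b y =
  cyl_coord ((if b then 1 else -1) / Num.sqrt (P (tcoord y))) 0.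
Proof.
move=> Vy; rewrite /outward_normal !(invmx_warpedE Vy) sqrtrV ?ltW // invrK.
have sn0 : Num.sqrt (P (tcoord y)) != 0 by rewrite gt_eqF // sqrtr_gt0.
apply/rowP => i; rewrite !mxE; case: split_ordP => j ->.
  rewrite (ord1 j) (invmx_warpedE Vy) !mxE -[in X in _ * X](sqr_sqrtr (ltW (P0 (tcoord y)))).
  by field.
by rewrite (invmx_warpedE Vy) !mxE mulr0.
Qed.

Lemma induced_metric_warped b x : induced_metric W b x = Q b%:R *: g x.
Proof.
by rewrite /induced_metric /warped block_mxKdr /face tcoord_cyl_coord rsubmx_cyl_coord.
Qed.

Lemma second_form_warped b x : V x -> second_form W b x =
  ((if b then 1 else -1) * be b%:R / Num.sqrt (P b%:R) * Q b%:R) *: g x.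
Proof.
move=> Vx; apply/matrixP => a c; rewrite !mxE sum_cyl.
set y := face b x; have ty : tcoord y = b%:R by exact: tcoord_cyl_coord.
have xy : rsubmx y = x by exact: rsubmx_cyl_coord.
have Vy : V (rsubmx y) by rewrite xy.
pose s : R := if b then 1 else -1.
(* The components of the normal depend on [t] alone, so the covariant derivative along the slice
   reduces to its Christoffel term, where only the component [a] contributes. *)
have pdo e : pd (r a) (fun y => outward_normal W b y 0 e) y = 0.
  rewrite (@pd_eq_on _ _ _ _ (fun y => cyl_coord (s / Num.sqrt (P (tcoord y))) 0 0 e)
    _ _ open_cylinder Vy) => [|z Vz]; last by rewrite outward_normal_warped.
  case: (split_ordP e) => j ->.
    rewrite (_ : (fun _ => _) = (fun y => s / Num.sqrt (P (tcoord y)))).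
      exact: (pd_tcoord_r (fun t => s / Num.sqrt (P t))).
    by apply: funext => z; rewrite /cyl_coord row_mxEl mxE.
  rewrite (_ : (fun _ => _) = (fun=> 0)); first exact: derive_cst.
  by apply: funext => z; rewrite /cyl_coord row_mxEr mxE.
rewrite warped_or mulr0 add0r.
rewrite (eq_bigr (fun e => s * be b%:R / Num.sqrt (P b%:R) * Q b%:R * (e == a)%:R * g x e c)).
  rewrite (bigD1 a) //= big1 => [|e /negbTE ->]; last by rewrite mulr0 mul0r.
  by rewrite eqxx mulr1 addr0.
move=> e _; rewrite /covariant pdo sum_cyl warped_rr outward_normal_warped //.
rewrite (christoffel_warped Vy).2.1.2 big1 => [|f _]; last first.
  by rewrite /cyl_coord row_mxEr mxE mulr0.
rewrite /cyl_coord row_mxEl mxE xy ty -/s; ring.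
Qed.

Lemma mean_curvature_warped b x : V x -> mean_curvature W b x =
  (if b then 1 else -1) * d%:R * be b%:R / Num.sqrt (P b%:R).
Proof.
move=> Vx; rewrite /mean_curvature induced_metric_warped second_form_warped //.
have Qg : invmx (Q b%:R *: g x) = (Q b%:R)^-1 *: invmx (g x).
  have qg : (Q b%:R)^-1 *: invmx (g x) *m (Q b%:R *: g x) = 1%:M.
    by rewrite -scalemxAl -scalemxAr scalerA mulVmx ?gunit // mulVf ?scale1r ?gt_eqF.
  have [_ Qu] := mulmx1_unit qg.
  by rewrite -[LHS]mul1mx -qg -mulmxA mulmxV // mulmx1.
rewrite Qg -scalemxAl -scalemxAr scalerA mulVmx ?gunit // mxtraceZ mxtrace1.
by have := gt_eqF (Q0 b%:R) => /negbT Qn0; field; rewrite Qn0 gt_eqF // sqrtr_gt0.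
Qed.

End WarpedProduct.

(** * Tensors on the cylinder *)

Lemma posdef_unitmx {R : realType} {n : nat} (S : 'M[R]_n) :
  (forall v, v != 0 -> 0 < metric_dot S v v) -> S \in unitmx.
Proof.
move=> pos; rewrite unitmxE unitfE; apply/negP => /det0P[v v0 vS].
by have := pos v v0; rewrite /metric_dot vS mul0mx mxE ltxx.
Qed.

Section CylinderTensors.
Context {R : realType} {d : nat}.

Notation o := (lshift d (@ord0 0)).
Notation r := (rshift 1).

Lemma continuous_tcoord : continuous (@tcoord R d).
Proof.
rewrite (_ : @tcoord R d = (fun y => y 0 o)); first exact: coord_continuous.
by apply: funext => y; rewrite /tcoord mxE.
Qed.

Lemma Ck_tcoord k : Ck k setT (@tcoord R d).
Proof.
case: k => [|k]; split => //; try by move=> x _; exact: continuous_tcoord.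
move=> a; have tl x h := @tcoord_linear R d h (delta_mx 0 a) x.
split.
  by move=> x _; apply: (@derivable_comp_affine _ _ _ _ _ id _ _ (tl x)); exact: derivable_id.
rewrite (_ : pd a _ = fun=> tcoord (delta_mx 0 a)); first exact: Ck_cst.
apply: funext => x; rewrite /pd (derive_comp_affine id (tl x)); exact: derive_id.
Qed.

Lemma Ck_rsubmx k (U : set 'rV[R]_d) (f : 'rV[R]_d -> R) : Ck k U f ->
  Ck k ((@rsubmx R 1 1 d) @^-1` U) (fun y => f (rsubmx y)).
Proof.
apply: (@Ck_comp_linear R _ _ (@rsubmx R 1 1 d)).
- exact: continuous_rsubmx.
- by move=> h v w; exact: rsubmx_linear.
- move=> a; case: (split_ordP a) => j ->.
    by left; rewrite (ord1 j) rsubmx_delta_l.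
  by right; exists j; exact: rsubmx_delta_r.
Qed.

(** The neighbourhood used is [U] times the whole line, so the ends of the interval need no separate
    treatment. *)
Lemma smooth_on_cyl_mul (V : set 'rV[R]_d) (C : set 'rV[R]_(1 + d)) (F : R -> R)
    (f : 'rV[R]_d -> R) : (forall y, C y -> V (rsubmx y)) ->
  (forall k, Ck k setT (fun y : 'rV[R]_(1 + d) => F (tcoord y))) -> smooth_on V f ->
  smooth_on C (fun y => F (tcoord y) * f (rsubmx y)).
Proof.
move=> CV sF [U [oU VU sf]]; exists ((@rsubmx R 1 1 d) @^-1` U); split.
- exact: open_cylinder.
- by move=> y /CV /VU.
move=> k; apply: Ck_mul; first exact: open_cylinder.
  by apply: Ck_subset (sF k).
exact: Ck_rsubmx.
Qed.

Lemma smooth_on_Ck (C : set 'rV[R]_(1 + d)) (f : 'rV[R]_(1 + d) -> R) :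
  (forall k, Ck k setT f) -> smooth_on C f.
Proof. by move=> sf; exists setT; split => //; exact: openT. Qed.

Context {T : Type} (A : atlas R d T).

Lemma cimage_cyl i y : cimage (cyl_atlas A) i y -> cimage A i (rsubmx y).
Proof. by case=> -[p t] /= [pi _] <-; rewrite rsubmx_cyl_coord; exists p. Qed.

(** A transition of product charts is the identity in [t] times a transition of the base. *)
Lemma Jac_cyl_transition i j y : Jac (transition (cyl_atlas A) i j) y =
  block_mx 1%:M 0 0 (Jac (transition A i j) (rsubmx y)).
Proof.
have Eo : (fun y => transition (cyl_atlas A) i j y 0 o) = (fun y => tcoord y).
  by apply: funext => z; rewrite /transition /= row_mxEl mxE.
have Er b : (fun y => transition (cyl_atlas A) i j y 0 (r b)) =
    (fun y => transition A i j (rsubmx y) 0 b).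
  by apply: funext => z; rewrite /transition /= row_mxEr.
apply/matrixP => a b; rewrite mxE.
case: (split_ordP a) => a' ->; case: (split_ordP b) => b' ->.
- rewrite block_mxEul (ord1 a') (ord1 b') Eo (pd_tcoord_l id) mxE eqxx.
  exact: derive_id.
- rewrite block_mxEur (ord1 a') Er mxE.
  exact: (pd_rsubmx_l (fun x => transition A i j x 0 b')).
- by rewrite block_mxEdl (ord1 b') Eo (pd_tcoord_r id) mxE.
- rewrite block_mxEdr Er mxE.
  exact: (pd_rsubmx_r (fun x => transition A i j x 0 b')).
Qed.

Lemma metric_dot_warped (P Q : R -> R) (g : 'rV[R]_d -> 'M[R]_d) y v w :
  metric_dot (warped P Q g y) v w = P (tcoord y) * (tcoord v * tcoord w)
    + Q (tcoord y) * metric_dot (g (rsubmx y)) (rsubmx v) (rsubmx w).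
Proof.
rewrite /metric_dot -[in LHS](hsubmxK v) -[in LHS](hsubmxK w) tr_row_mx.
rewrite /warped mul_row_block !mulmx0 addr0 add0r mul_row_col mxE.
congr (_ + _); last by rewrite -scalemxAr -scalemxAl mxE.
by rewrite !(mxE, big_ord1) /= mulr1n /tcoord !mxE mulrAC mulrC.
Qed.

Lemma warped_riemannian (g : chart_index A -> 'rV[R]_d -> 'M[R]_d) (P Q : R -> R) :
  riemannian_metric A g -> (forall t, 0 < P t) -> (forall t, 0 < Q t) ->
  (forall k, Ck k setT (fun y : 'rV[R]_(1 + d) => P (tcoord y))) ->
  (forall k, Ck k setT (fun y : 'rV[R]_(1 + d) => Q (tcoord y))) ->
  @riemannian_metric R (1 + d) _ (cyl_atlas A) (fun i => warped P Q (g i)).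
Proof.
move=> hg P0 Q0 sP sQ; split.
- move=> i a b; case: (split_ordP a) => a' ->; case: (split_ordP b) => b' ->.
  + rewrite (ord1 a') (ord1 b') (_ : (fun _ => _) = (fun y => P (tcoord y))).
      exact: smooth_on_Ck.
    by apply: funext => y; exact: warped_oo.
  + rewrite (ord1 a') (_ : (fun _ => _) = (fun=> 0)).
      by apply: smooth_on_Ck => k; exact: Ck_cst.
    by apply: funext => y; exact: warped_or.
  + rewrite (ord1 b') (_ : (fun _ => _) = (fun=> 0)).
      by apply: smooth_on_Ck => k; exact: Ck_cst.
    by apply: funext => y; exact: warped_ro.
  + rewrite (_ : (fun _ => _) = (fun y => Q (tcoord y) * g i (rsubmx y) a' b')).
      apply: (@smooth_on_cyl_mul _ _ Q (fun x => g i x a' b') (@cimage_cyl i) sQ).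
      exact: (rm_smooth hg).
    by apply: funext => y; exact: warped_rr.
- move=> i y /cimage_cyl Vy; rewrite /warped tr_block_mx !trmx0 tr_scalar_mx linearZ /=.
  by rewrite (rm_sym hg).
- move=> i y /cimage_cyl Vy v v0; rewrite metric_dot_warped -expr2.
  (* If the slice part of [v] vanishes, positivity comes from the [P] term; otherwise it comes from
     the [Q] term. *)
  have [rv|rv] := eqVneq (rsubmx v) 0.
    have tv : tcoord v != 0.
      apply: contra_neq v0 => tv; rewrite -(hsubmxK v) rv.
      have -> : lsubmx v = 0 by apply/rowP => a; rewrite (ord1 a) [LHS]tv mxE.
      by rewrite row_mx0.
    rewrite rv /metric_dot !mul0mx mxE mulr0 addr0 mulr_gt0 //.
    by rewrite exprn_even_gt0.
  apply: ltr_wpDl; first by rewrite mulr_ge0 ?sqr_ge0 // ltW.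
  by rewrite mulr_gt0 //; exact: (rm_pos hg).
- move=> i j [p t] [/= pi _] [/= pj _].
  rewrite Jac_cyl_transition /warped !tcoord_cyl_coord !rsubmx_cyl_coord.
  rewrite (rm_transform hg pi pj) tr_block_mx !trmx0 trmx1 !mulmx_block.
  rewrite !mul0mx !mulmx0 !mulmx1 !mul1mx !addr0 !add0r.
  by rewrite mul0mx -scalemxAr -scalemxAl.
Qed.

(** The interval direction is the same vector in all product charts and [phi] is a function on the
    base, so the components agree on overlaps. *)
Lemma cyl_vector_field (e : R -> R) (phi : T -> R) :
  (forall (i : chart_index A) p, cdom i p -> cinv i (chart i p) = p) ->
  (forall k, Ck k setT (fun y : 'rV[R]_(1 + d) => e (tcoord y))) ->
  smooth_function A phi ->
  @vector_field R (1 + d) _ (cyl_atlas A) (fun (i : chart_index A) y =>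
    cyl_coord (e (tcoord y) * phi (cinv i (rsubmx y))) 0).
Proof.
move=> ck se sphi; split.
- move=> /= i a; case: (split_ordP a) => a' ->.
    rewrite (_ : (fun _ => _) = (fun y => e (tcoord y) * phi (@cinv _ _ _ A i (rsubmx y)))).
      exact: (@smooth_on_cyl_mul _ _ e (fun x => phi (@cinv _ _ _ A i x)) (@cimage_cyl i) se).
    by apply: funext => y; rewrite /cyl_coord row_mxEl mxE.
  rewrite (_ : (fun _ => _) = (fun=> 0)).
    by apply: smooth_on_Ck => k; exact: Ck_cst.
  by apply: funext => y; rewrite /cyl_coord row_mxEr mxE.
- move=> i j [p t] [/= pi _] [/= pj _].
  rewrite Jac_cyl_transition !tcoord_cyl_coord !rsubmx_cyl_coord !ck //.
  by rewrite /cyl_coord mul_row_block mulmx1 !mulmx0 mul0mx !addr0.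
Qed.

End CylinderTensors.

(** * The charged collar *)

(** Writing the derivative as a multiple of the power itself gives logarithmic derivatives directly
    and lets [field] treat the power as an atom. *)
Lemma is_derive1_powR_log {R : realType} (w : R -> R) (dw p t : R) : 0 < w t ->
  is_derive t 1 w dw -> is_derive t 1 (fun t => w t `^ p) (p * dw / w t * w t `^ p).
Proof.
move=> w0 hw; have := is_derive1_comp (is_derive1_powR p w0) hw.
have wn0 : w t != 0 by rewrite gt_eqF.
move=> /is_derive_eq; apply; rewrite powRB ?wn0 ?implybT // powRr1 ?ltW //.
by field.
Qed.

Section Profile.
Context {R : realType} (m z0 z1 q : R).
Context (m1 : 1 < m) (z1_gt0 : 0 < z1) (z10 : z1 < z0) (z0_lt1 : z0 < 1) (q0 : 0 < q).

Let c := 1 - z0.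
Let eps := (m - 1)^-1.
Let k2 := 4 * c * eps ^+ 2 * (z0 * z1) / q ^+ 2.

(* [k2] makes [profile_P] equal to [(du/dt)^2 / (du/ds)^2], where
   [u = z^eps] and [(du/ds)^2 = q^2 (z - z0) (z - z1) / (z0 z1 z^2)]; the factor
   [t^2] of [z - z0] cancels. *)
Definition profile_z (t : R) : R := z0 + c * t ^+ 2.
Definition profile_s (t : R) : R := profile_z t - z1.
Definition profile_Q (t : R) : R := profile_z t `^ (2 * eps).
Definition profile_P (t : R) : R := k2 * (profile_Q t * profile_s t `^ (- 1)).
(** This is [u^(-m) / sqrt P] with [u = z^eps], the division by [sqrt P] turning [d/ds] into [d/dt];
    note [1 + 2 * eps = (m + 1) * eps]. *)
Definition profile_e (t : R) : R :=
  (Num.sqrt k2)^-1 * (profile_s t `^ 2^-1 * profile_z t `^ (- 1 - 2 * eps)).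
(** The factor [t], inherited from the critical point of [z] at [0], is what makes the slice [t = 0]
    minimal. *)
Definition profile_be (t : R) : R := 2 * c * eps * t / profile_z t.
Definition profile_al (t : R) : R := profile_be t - c * t / profile_s t.
Definition profile_dbe (t : R) : R :=
  2 * c * eps * (profile_z t - 2 * c * t ^+ 2) / profile_z t ^+ 2.

Notation z := profile_z.
Notation s := profile_s.
Notation P := profile_P.
Notation Q := profile_Q.
Notation e := profile_e.
Notation be := profile_be.
Notation al := profile_al.
Notation dbe := profile_dbe.

Let c0 : 0 < c. Proof. by rewrite subr_gt0. Qed.
Let eps0 : 0 < eps. Proof. by rewrite invr_gt0 subr_gt0. Qed.
Let z00 : 0 < z0. Proof. exact: lt_trans z10. Qed.
Let k20 : 0 < k2.
Proof.
apply: divr_gt0; last exact: exprn_gt0.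
apply: mulr_gt0; last exact: mulr_gt0.
apply: mulr_gt0; last exact: exprn_gt0.
exact: mulr_gt0.
Qed.

Lemma profile_s_gt0 t : 0 < s t.
Proof.
rewrite /s /z addrAC ltr_wpDr ?subr_gt0 // mulr_ge0 ?sqr_ge0 //; exact: ltW.
Qed.

Lemma profile_z_gt0 t : 0 < z t.
Proof. by have := profile_s_gt0 t; rewrite /s subr_gt0; exact: lt_trans. Qed.

Lemma profile_Q_gt0 t : 0 < Q t. Proof. exact: powR_gt0 (profile_z_gt0 t). Qed.

Lemma profile_P_gt0 t : 0 < P t.
Proof.
by rewrite mulr_gt0 // mulr_gt0 ?profile_Q_gt0 // powR_gt0 // profile_s_gt0.
Qed.

Lemma profile_e_gt0 t : 0 < e t.
Proof.
rewrite /e mulr_gt0 ?invr_gt0 ?sqrtr_gt0 // mulr_gt0 // powR_gt0 //.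
  exact: profile_s_gt0.
exact: profile_z_gt0.
Qed.

Lemma profile_P_def t : P t = k2 * Q t / s t.
Proof. by rewrite /P powR_inv1 ?mulrA // ltW // profile_s_gt0. Qed.

Lemma profile_e_def t : e t = Num.sqrt (s t) / (Num.sqrt k2 * z t * Q t).
Proof.
have zn0 : z t != 0 by rewrite gt_eqF ?profile_z_gt0.
rewrite /e powR12_sqrt ?ltW ?profile_s_gt0 // powRB ?zn0 ?implybT //.
rewrite powR_inv1 ?ltW ?profile_z_gt0 // -/(Q t); field.
by rewrite zn0 !gt_eqF ?profile_Q_gt0 ?sqrtr_gt0.
Qed.

(** The squared length of [e d/dt]; the right-hand side is [u^(-2m)]. *)
Lemma profile_eP t : e t ^+ 2 * P t = (z t ^+ 2 * Q t)^-1.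
Proof.
rewrite profile_e_def profile_P_def expr_div_n !exprMn !sqr_sqrtr ?ltW ?profile_s_gt0 //.
by field; rewrite !gt_eqF ?profile_Q_gt0 ?profile_z_gt0 ?profile_s_gt0.
Qed.

Lemma is_derive_profile_z (t : R) : is_derive t 1 z (2 * c * t).
Proof.
have H : is_derive t 1 z _ := is_deriveD (is_derive_cst z0 t 1)
  (is_deriveZ c (is_deriveM (is_derive_id t 1) (is_derive_id t 1))).
by apply: (is_derive_eq H); rewrite /GRing.scale /=; ring.
Qed.

Lemma is_derive_profile_s (t : R) : is_derive t 1 s (2 * c * t).
Proof.
have H : is_derive t 1 s _ := is_deriveB (is_derive_profile_z t) (is_derive_cst z1 t 1).
by apply: (is_derive_eq H); rewrite subr0.
Qed.

Lemma is_derive_profile_Q (t : R) : is_derive t 1 Q (2 * be t * Q t).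
Proof.
have H : is_derive t 1 Q _ := is_derive1_powR_log (2 * eps) (profile_z_gt0 t)
  (is_derive_profile_z t).
apply: (is_derive_eq H); rewrite -/(Q t) /be; field.
by rewrite gt_eqF ?profile_z_gt0.
Qed.

Lemma is_derive_profile_P (t : R) : is_derive t 1 P (2 * al t * P t).
Proof.
have hs := is_derive1_powR_log (- 1) (profile_s_gt0 t) (is_derive_profile_s t).
have H : is_derive t 1 P _ := is_deriveZ k2 (is_deriveM (is_derive_profile_Q t) hs).
apply: (is_derive_eq H); rewrite /GRing.scale /= /al /P; field.
by rewrite gt_eqF ?profile_s_gt0.
Qed.

Lemma is_derive_profile_be (t : R) : is_derive t 1 be (dbe t).
Proof.
have zn0 : z t != 0 by rewrite gt_eqF ?profile_z_gt0.
have H : is_derive t 1 be _ := is_deriveM (is_deriveZ (2 * c * eps) (is_derive_id t 1))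
  (is_deriveV zn0 (is_derive_profile_z t)).
by apply: (is_derive_eq H); rewrite /= /GRing.scale /= /dbe; field.
Qed.

Lemma is_derive_profile_e (t : R) :
  is_derive t 1 e ((c * t / s t - (1 + 2 * eps) * (2 * c * t) / z t) * e t).
Proof.
have hs := is_derive1_powR_log 2^-1 (profile_s_gt0 t) (is_derive_profile_s t).
have hz := is_derive1_powR_log (- 1 - 2 * eps) (profile_z_gt0 t) (is_derive_profile_z t).
have H : is_derive t 1 e _ := is_deriveZ (Num.sqrt k2)^-1 (is_deriveM hs hz).
apply: (is_derive_eq H); rewrite /GRing.scale /= /e; field.
by rewrite !gt_eqF ?profile_s_gt0 ?profile_z_gt0 ?sqrtr_gt0.
Qed.

(** In the logarithmic derivative of [e] the [s] term cancels against that of [al], and the [z] term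
    against [(m + 1) * be], because [(m + 1) * eps = 1 + 2 * eps]. *)
Lemma profile_divergence_free t : 'D_1 e t + (al t + m * be t) * e t = 0.
Proof.
have [_ ->] := is_derive_profile_e t; rewrite /al /be /eps; field.
by rewrite !gt_eqF ?profile_s_gt0 ?profile_z_gt0 ?subr_gt0.
Qed.

(** The mass term of [(du/ds)^2], proportional to [1 / z], contributes nothing; the constant
    [K = q^2 / (z0 z1)] and the charge term give the two summands. *)
Lemma profile_curvature t :
  m / P t * (2 * al t * be t - 2 * dbe t - (m + 1) * be t ^+ 2) =
  m * (m - 1) / Q t * (q ^+ 2 / z t ^+ 2 - q ^+ 2 / (z0 * z1)).
Proof.
have zn0 : z t != 0 by rewrite gt_eqF ?profile_z_gt0.
have sn0 : s t != 0 by rewrite gt_eqF ?profile_s_gt0.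
have Qn0 : Q t != 0 by rewrite gt_eqF ?profile_Q_gt0.
(* All real powers sit in [Q t]; once it is abstracted, the identity is rational in [t]. *)
rewrite profile_P_def /al /be /dbe /k2 /eps; move: (Q t) Qn0 => Qt Qn0.
move: zn0 sn0; rewrite /s /z => zn0 sn0.
have cn0 : c != 0 by rewrite gt_eqF.
field.
by rewrite zn0 sn0 Qn0 cn0 !gt_eqF ?subr_gt0.
Qed.

Lemma profile_at1 : z 1 = 1 /\ Q 1 = 1.
Proof.
have z_1 : z 1 = 1 by rewrite /z expr1n mulr1 /c addrC subrK.
by split => //; rewrite /Q z_1 powR1.
Qed.

Lemma profile_flux1 : e 1 * Num.sqrt (P 1) = 1.
Proof.
have [z_1 Q_1] := profile_at1; have e1 := ltW (profile_e_gt0 1).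
have := profile_eP 1; rewrite z_1 Q_1 expr1n mulr1 invr1 => eP.
by rewrite -{1}(ger0_norm e1) -sqrtr_sqr -sqrtrM ?sqr_ge0 // eP sqrtr1.
Qed.

(** The hypothesis says that [(du/ds)^2 = h^2] at [u = 1], and the mean curvature of a slice is
    [m (du/ds) / u]. *)
Lemma profile_mean_curvature1 (h : R) : 0 < h ->
  q ^+ 2 * ((1 - z0) * (1 - z1)) = h ^+ 2 * (z0 * z1) ->
  m * be 1 / Num.sqrt (P 1) = m * h.
Proof.
move=> h0 qh; have [z_1 Q_1] := profile_at1.
have s1 : s 1 = 1 - z1 by rewrite /s z_1.
have s10 : 1 - z1 != 0 by rewrite -s1 gt_eqF ?profile_s_gt0.
(* At [t = 1] one has [du/dt = 2 * c * eps], so [ds/dt = sqrt P] is this quantity divided by [h]. *)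
have P1 : P 1 = (2 * c * eps / h) ^+ 2.
  rewrite profile_P_def Q_1 s1 /k2.
  have -> : z0 * z1 = q ^+ 2 * ((1 - z0) * (1 - z1)) / h ^+ 2.
    by rewrite qh mulrAC mulfV ?mul1r // gt_eqF ?exprn_gt0.
  by rewrite -/c; field; rewrite s10 !gt_eqF.
rewrite P1 sqrtr_sqr ger0_norm; last by rewrite ltW // divr_gt0 // !mulr_gt0.
by rewrite /be z_1; field; rewrite !gt_eqF.
Qed.

Context {d : nat}.

Lemma Ck_profile_z k : Ck k setT (fun y : 'rV[R]_(1 + d) => z (tcoord y)).
Proof.
apply: Ck_add; [exact: openT | exact: Ck_cst |].
apply: Ck_mul; [exact: openT | exact: Ck_cst |].
by apply: Ck_mul; [exact: openT | exact: Ck_tcoord..].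
Qed.

Lemma Ck_profile_s k : Ck k setT (fun y : 'rV[R]_(1 + d) => s (tcoord y)).
Proof. by apply: Ck_add; [exact: openT | exact: Ck_profile_z | exact: Ck_cst]. Qed.

Lemma Ck_profile_zX p k : Ck k setT (fun y : 'rV[R]_(1 + d) => z (tcoord y) `^ p).
Proof.
by apply: Ck_powR; [exact: openT | move=> y _; exact: profile_z_gt0 | exact: Ck_profile_z].
Qed.

Lemma Ck_profile_sX p k : Ck k setT (fun y : 'rV[R]_(1 + d) => s (tcoord y) `^ p).
Proof.
by apply: Ck_powR; [exact: openT | move=> y _; exact: profile_s_gt0 | exact: Ck_profile_s].
Qed.

Lemma Ck_profile_P k : Ck k setT (fun y : 'rV[R]_(1 + d) => P (tcoord y)).
Proof.
apply: Ck_mul; [exact: openT | exact: Ck_cst |].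
by apply: Ck_mul; [exact: openT | exact: Ck_profile_zX | exact: Ck_profile_sX].
Qed.

Lemma Ck_profile_e k : Ck k setT (fun y : 'rV[R]_(1 + d) => e (tcoord y)).
Proof.
apply: Ck_mul; [exact: openT | exact: Ck_cst |].
by apply: Ck_mul; [exact: openT | exact: Ck_profile_sX | exact: Ck_profile_zX].
Qed.

End Profile.

(** With [K = q^2 / (z0 z1)], the last condition is [K (1 - z0) (1 - z1) = h^2], which prescribes
    the mean curvature, and [K <= k] is the room left by the scalar curvature of [g]. *)
Lemma exists_roots {R : realFieldType} (q h k : R) : 0 < q -> 0 < h -> (q + h) ^+ 2 < k ->
  exists z0 z1 : R, [/\ 0 < z1, z1 < z0, z0 < 1, q ^+ 2 / (z0 * z1) <= k
    & q ^+ 2 * ((1 - z0) * (1 - z1)) = h ^+ 2 * (z0 * z1)].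
Proof.
(* The last condition asks that the ratios [(1 - z) / z] of the two roots have product [(h / q)^2];
   they are taken to be [h / (q (1 + x))] and [h (1 + x) / q]. At [x = 0] the roots would coincide,
   with [K = (q + h)^2]; a positive [x] separates them. *)
move=> q0 h0 qhk; pose x := (k - (q + h) ^+ 2) / (q * h).
have qh0 : 0 < q * h by exact: mulr_gt0.
have x0 : 0 < x by rewrite divr_gt0 // subr_gt0.
pose a := q * (1 + x) + h; pose b := q + h * (1 + x).
have a0 : 0 < a by rewrite addr_gt0 // mulr_gt0 //; lra.
have b0 : 0 < b by rewrite addr_gt0 // mulr_gt0 //; lra.
exists (q * (1 + x) / a), (q / b); split.
- exact: divr_gt0.
- rewrite ltr_pdivrMr // mulrAC ltr_pdivlMr // /a /b; nra.
- rewrite ltr_pdivrMr // mul1r /a; lra.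
- have -> : q ^+ 2 / (q * (1 + x) / a * (q / b)) = a * b / (1 + x).
    by field; rewrite !gt_eqF //; lra.
  rewrite ler_pdivrMr; last by lra.
  (* Thus [K] exceeds [(q + h)^2] by [q h x^2 / (1 + x)]. By the choice of [x] this is the available
     gap [k - (q + h)^2] times [x / (1 + x)], which is below [1]. *)
  have -> : a * b = (1 + x) * (q + h) ^+ 2 + (q * h * x) * x by rewrite /a /b; ring.
  have -> : q * h * x = k - (q + h) ^+ 2 by rewrite /x; field; rewrite !gt_eqF.
  nra.
- have -> : 1 - q * (1 + x) / a = h / a.
    by rewrite /a; field; rewrite -/a gt_eqF.
  have -> : 1 - q / b = h * (1 + x) / b.
    by rewrite /b; field; rewrite -/b gt_eqF.
  by field; rewrite !gt_eqF.
Qed.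

(** * Assembly of the collar from the profile and the data *)

Theorem theorem5p1 (R : realType) (n d : nat) (hn : (3 <= n)%N) (hd : n = d.+1)
    (T : topologicalType) (A : atlas R d T) (hA : closed_manifold A)
    (g : chart_index A -> 'rV[R]_d -> 'M[R]_d) (hg : riemannian_metric A g)
    (H : R) (phi : T -> R) (hphi : smooth_function A phi)
    (hH : forall p : T, (n%:R - 1) * phi p < H /\ 0 < (n%:R - 1) * phi p)
    (Rmin phimax : R)
    (hRmin : is_min (scalar_curvature_values A g) Rmin)
    (hphimax : is_max (range phi) phimax)
    (hR : (n%:R - 2) / (n%:R - 1) * ((n%:R - 1) * phimax + H) ^+ 2 < Rmin) :
  exists (gamma : chart_index (cyl_atlas A) -> 'rV[R]_(1 + d) -> 'M[R]_(1 + d))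
         (E : chart_index (cyl_atlas A) -> 'rV[R]_(1 + d) -> 'rV[R]_(1 + d))
         (b : bool),
    [/\ riemannian_metric (cyl_atlas A) gamma,
        vector_field (cyl_atlas A) E,
        forall (i : chart_index (cyl_atlas A)) (y : 'rV[R]_(1 + d)), cimage (cyl_atlas A) i y ->
          divergence (gamma i) (E i) y = 0 /\
          (n%:R - 1) * (n%:R - 2) * metric_dot (gamma i y) (E i y) (E i y)
            <= scalar_curvature (gamma i) y,
        forall (i : chart_index A) (x : 'rV[R]_d), cimage A i x ->
          mean_curvature (gamma i) (~~ b) x = 0
      & forall (i : chart_index A) (x : 'rV[R]_d), cimage A i x ->
          [/\ induced_metric (gamma i) b x = g i x,
              mean_curvature (gamma i) b x = H
            & metric_dot (gamma i (face b x)) (E i (face b x))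
                (outward_normal (gamma i) b (face b x)) = phi (cinv i x)]].
Proof.
subst n; pose m : R := d%:R; have nm : d.+1%:R = m + 1 :> R by rewrite -natr1.
have {hn} m1 : 1 < m by rewrite /m ltr1n.
have m0 : 0 < m by lra.
have m10 : 0 < m - 1 by lra.
have [[p0 _ phip0] phi_le] := hphimax.
have n1 : d.+1%:R - 1 = m :> R by rewrite nm; ring.
have n2 : d.+1%:R - 2 = m - 1 :> R by rewrite nm; ring.
rewrite n1 n2 in hH hR *.
have phi0 p : 0 < phi p by have [_] := hH p; rewrite pmulr_rgt0.
have q0 : 0 < phimax by rewrite -phip0.
have H0 : 0 < H by have [a b] := hH p0; exact: lt_trans a.
pose h := H / m; have h0 : 0 < h by exact: divr_gt0.
(* This is the assumed curvature bound divided by [m * (m - 1)], with [h = H / m]. *)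
have qhk : (phimax + h) ^+ 2 < Rmin / (m * (m - 1)).
  rewrite ltr_pdivlMr ?mulr_gt0 //; apply: le_lt_trans hR; rewrite le_eqVlt.
  by apply/orP; left; apply/eqP; rewrite /h; field; rewrite gt_eqF.
have [z0 [z1 [z1_gt0 z10 z0_lt1 Kk qh]]] := exists_roots q0 h0 qhk.
pose P := profile_P m z0 z1 phimax; pose Q := profile_Q m z0.
pose e := profile_e m z0 z1 phimax.
pose al := profile_al m z0 z1; pose be := profile_be m z0.
have P0 t : 0 < P t by exact: profile_P_gt0.
have Q0 t : 0 < Q t by exact: (@profile_Q_gt0 _ m z0 z1).
have dP (t : R) : is_derive t 1 P (2 * al t * P t) by exact: is_derive_profile_P.
have dQ (t : R) : is_derive t 1 Q (2 * be t * Q t) by exact: (@is_derive_profile_Q _ m z0 z1).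
have dB (t : R) : is_derive t 1 be (profile_dbe m z0 t).
  exact: (@is_derive_profile_be _ m z0 z1).
have oV i : open (cimage A i) by exact: (cm_open_image hA).
have gunit i x : cimage A i x -> g i x \in unitmx.
  by move=> Vx; apply: posdef_unitmx; exact: (rm_pos hg).
have gder i x : cimage A i x -> forall a b c : 'I_d,
    derivable (fun y => g i y b c) x (delta_mx 0 a).
  move=> Vx a b c; have [U [_ VU /(_ 1%N) [_ /(_ a) [dg _]]]] := @rm_smooth _ _ _ _ _ hg i b c.
  exact/dg/VU.
have gsym i x : cimage A i x -> (g i x)^T = g i x by exact: (rm_sym hg).
exists (fun i => warped P Q (g i)).
exists (fun (i : chart_index A) y =>
  cyl_coord (e (tcoord y) * phi (cinv i (rsubmx y))) 0).
(* The data are attained at [t = 1]; the horizon is the face [t = 0]. *)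
exists true; split.
- apply: warped_riemannian => // k.
    exact: Ck_profile_P.
  exact: (@Ck_profile_zX _ z0 z1).
- apply: cyl_vector_field => // [|k]; first exact: (cm_cancel hA).
  exact: Ck_profile_e.
- move=> i y /cimage_cyl Vy; split.
    rewrite (divergence_warped P0 Q0 dP dQ (gsym i) (gunit i) (gder i)
      (fun x => phi (@cinv _ _ _ A i x)) Vy).
      by rewrite profile_divergence_free ?mul0r.
    by have [] := is_derive_profile_e m1 z1_gt0 z10 z0_lt1 q0 (tcoord y).
  rewrite (scalar_curvature_warped P0 Q0 dP dQ dB (oV i) (gsym i) (gunit i) (gder i) Vy).
  rewrite profile_curvature // metric_dot_warped tcoord_cyl_coord rsubmx_cyl_coord.
  rewrite /metric_dot !mul0mx mxE mulr0 addr0.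
  set f := phi _; set t := tcoord y.
  have Rg : Rmin <= scalar_curvature (g i) (rsubmx y).
    by apply: hRmin.2; exists i, (rsubmx y).
  have z_gt0 := profile_z_gt0 z1_gt0 z10 z0_lt1 t.
  have -> : P t * (e t * f * (e t * f)) = f ^+ 2 * (e t ^+ 2 * P t) by ring.
  rewrite profile_eP // -/Q.
  have -> : m * (m - 1) * (f ^+ 2 * (profile_z z0 t ^+ 2 * Q t)^-1) =
      m * (m - 1) * (f ^+ 2 / profile_z z0 t ^+ 2) / Q t.
    by field; rewrite !gt_eqF.
  (* After clearing [Q t], the claim follows from [f <= phimax] for the charge terms and from
     [m (m - 1) K <= Rmin] for the constant. *)
  rewrite [m * (m - 1) / Q t * _]mulrAC -mulrDl ler_pM2r ?invr_gt0 //.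
  have mm : 0 < m * (m - 1) by exact: mulr_gt0.
  have Kle : m * (m - 1) * (phimax ^+ 2 / (z0 * z1)) <= Rmin.
    by rewrite mulrC -ler_pdivlMr.
  have f2 : f ^+ 2 / profile_z z0 t ^+ 2 <= phimax ^+ 2 / profile_z z0 t ^+ 2.
    have f0 : 0 <= f by apply: ltW; exact: phi0.
    rewrite ler_pM2r ?invr_gt0 ?exprn_gt0 // ler_sqr ?nnegrE ?f0 ?(ltW q0) //.
    by apply: phi_le; exists (@cinv _ _ _ A i (rsubmx y)).
  rewrite mulrBr; move: (ler_wpM2l (ltW mm) f2) => f2m.
  lra.
- move=> i x Vx /=.
  rewrite (mean_curvature_warped P0 Q0 dP dQ (oV i) (gsym i) (gunit i) (gder i)) //.
  by rewrite /be /profile_be mulr0 !mul0r mulr0 mul0r.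
- move=> i x Vx; have [z_1 Q_1] := profile_at1 m z0.
  split.
  + by rewrite induced_metric_warped mulr1n /Q Q_1 scale1r.
  + rewrite (mean_curvature_warped P0 Q0 dP dQ (oV i) (gsym i) (gunit i) (gder i)) //.
    rewrite mulr1n mul1r (_ : _ / _ = m * h).
      by rewrite /h; field; rewrite gt_eqF.
    exact: profile_mean_curvature1.
  + have xy : rsubmx (face true x) = x :> 'rV[R]_d by exact: rsubmx_cyl_coord.
    rewrite (outward_normal_warped P0 Q0 (gunit i)) ?xy // metric_dot_warped.
    rewrite !tcoord_cyl_coord !rsubmx_cyl_coord.
    rewrite /metric_dot !mul0mx mxE mulr0 addr0 mulr1n.
    have eP : e 1 * Num.sqrt (P 1) = 1 by exact: profile_flux1.
    have sP : 0 < Num.sqrt (P 1) by rewrite sqrtr_gt0.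
    (* Pairing with the unit normal [d/dt / sqrt P] leaves [sqrt P] times the component of [E], and
       [e * sqrt P = u^(-m)] is [1] at [u = 1]. *)
    transitivity (e 1 * Num.sqrt (P 1) * phi (cinv i x)); last by rewrite eP mul1r.
    rewrite -{1}(sqr_sqrtr (ltW (P0 1))).
    by field; rewrite gt_eqF.
Qed.
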